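(* The linear maps $P\mapsto ehr_P(X)$ and $P\mapsto ehr^{str}_P(X)$ (respectively $\lfloor P\rfloor\mapsto ehr_P(X)$ and $\lfloor P\rfloor\mapsto ehr^{str}_P(X)$) define Hopf algebra morphisms $$ehr,\ ehr^{str}:\ (\mathcal{H}_{\mathbf{QP}},m,\Delta)\to(\mathbb{K}[X],m,\Delta),\quad (\mathcal{H}_{\mathbf{qp}},m,\Delta)\to(\mathbb{K}[X],m,\Delta),\quad (\mathcal{H}_{\mathbf{p}},m,\Delta)\to(\mathbb{K}[X],m,\Delta).$$
   Context: $\mathbb{K}$ is a field of characteristic zero, $[n]=\{1,\ldots,n\}$. A quasi-poset is a pair $P=(A,\leq_P)$ with $A$ a finite set and $\leq_P$ a reflexive transitive relation; $i\sim_P j$ means $i\leq_P j$ and $j\leq_P i$. $\lfloor P\rfloor$ is the isomorphism class of $P$; $P_{\mid B}$ is the restriction of $P$ to $B\subseteq A$. An open set of $P$ is a subset $O\subseteq A$ such that $i\in O$ and $i\leq_P j$ imply $j\in O$; $top(P)$ is the set of open sets. $\mathbf{QP}(n)$ is the set of quasi-posets on $[n]$, $\mathbf{QP}=\bigsqcup_{n\ge0}\mathbf{QP}(n)$, $\mathbf{qp}$ (resp. $\mathbf{p}$) is the set of isoclasses of finite quasi-posets (resp. finite posets). $\mathcal{H}_{\mathbf{QP}},\mathcal{H}_{\mathbf{qp}},\mathcal{H}_{\mathbf{p}}$ are the $\mathbb{K}$-vector spaces with bases $\mathbf{QP},\mathbf{qp},\mathbf{p}$. If $P$ is a quasi-poset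 on a finite totally ordered set with $n$ elements, $Std(P)\in\mathbf{QP}(n)$ is obtained by transport along the increasing bijection with $[n]$. Hopf structures: on $\mathcal{H}_{\mathbf{QP}}$, for $P\in\mathbf{QP}(k)$, $Q\in\mathbf{QP}(l)$, $PQ=m(P\otimes Q)\in\mathbf{QP}(k+l)$ is the disjoint union of $P$ on $[k]$ and of $Q$ shifted by $k$ on $\{k+1,\ldots,k+l\}$; for $P\in \mathbf{QP}(n)$, $\Delta(P)=\sum_{O\in top(P)}Std(P_{\mid[n]\setminus O})\otimes Std(P_{\mid O})$. The unit is the empty quasi-poset $1$ and the counit $\varepsilon$ sends $1$ to $1$ and all other quasi-posets to $0$. On $\mathcal{H}_{\mathbf{qp}}$ the product is disjoint union and $\Delta(\lfloor P\rfloor)=\sum_{O\in top(P)}\lfloor P_{\mid A\setminus O}\rfloor\otimes\lfloor P_{\mid O}\rfloor$; $\mathcal{H}_{\mathbf{p}}$ is the Hopf subalgebra of $\mathcal{H}_{\mathbf{qp}}$ spanned by isoclasses of posets. These are Hopf algebras. $\mathbb{K}[X]$ has its usual product $m$ and coproduct $\Delta(X)=X\otimes1+1\otimes X$. For $P=(A,\leq_P)$ and $k\ge1$, $L_P(k)$ is the set of maps $f:A\to[k]$ with $i\leq_Pj\Rightarrow f(i)\leq f(j)$, and $L^{str}_P(k)$ is the set of $f\in L_P(k)$ such that ($i\leq_P j$ and $f(i)=f(j)$) implies $i\sim_Pj$. For $k=0$ both are empty if $P\neq1$ and have one element if $P=1$. $ehr_P,ehr_P^{str}\in\mathbb{Q}[X]$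 are the unique polynomials such that $ehr_P(k)=\sharp L_P(k)$ and $ehr^{str}_P(k)=\sharp L_P^{str}(k)$ for all $k\geq0$; they depend only on $\lfloor P\rfloor$. *)

(* Defs.v *)
From HB Require Import structures.
From mathcomp Require Import all_boot all_order all_algebra.
From mathcomp Require Import zify finmap.
From mathcomp.multinomials Require Import monalg.

Set Implicit Arguments.
Unset Strict Implicit.
Unset Printing Implicit Defensive.

Import GRing.Theory.

Local Open Scope ring_scope.
Local Open Scope quotient_scope.

Definition is_preorder (A : finType) (r : {set A * A}) : bool :=
  [forall x, (x, x) \in r] &&
  [forall x, forall y, forall z,
     ((x, y) \in r) && ((y, z) \in r) ==> ((x, z) \in r)].

Record qposet (A : finType) := QPoset {
  qgraph : {set A * A};
  qgraphP : is_preorder qgraph }.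

HB.instance Definition _ (A : finType) := [isSub for @qgraph A].
HB.instance Definition _ (A : finType) := [Finite of qposet A by <:].

Definition qle (A : finType) (P : qposet A) : rel A :=
  fun x y => (x, y) \in qgraph P.

Definition qequiv (A : finType) (P : qposet A) : rel A :=
  fun x y => qle P x y && qle P y x.

Lemma qle_refl (A : finType) (P : qposet A) : reflexive (qle P).
Proof. by move=> x; case/andP: (qgraphP P) => /forallP/(_ x). Qed.

Lemma qle_trans (A : finType) (P : qposet A) : transitive (qle P).
Proof.
move=> y x z hxy hyz; case/andP: (qgraphP P) => _.
by move=> /'forall_'forall_'forall_implyP; apply; apply/andP; split; [exact: hxy|].
Qed.

Fact mkqposet_subproof (A : finType) (r : rel A) :
  reflexive r -> transitive r -> is_preorder [set u : A * A | r u.1 u.2].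
Proof.
move=> rr rt; apply/andP; split; first by apply/forallP => x; rewrite inE.
do 3![apply/forallP => ?]; rewrite !inE /=; apply/implyP => /andP[].
exact: rt.
Qed.

Definition mkqposet (A : finType) (r : rel A) (rr : reflexive r)
  (rt : transitive r) : qposet A := QPoset (mkqposet_subproof rr rt).

Lemma mkqposetE (A : finType) (r : rel A) rr rt x y :
  qle (@mkqposet A r rr rt) x y = r x y.
Proof. by rewrite /qle /= inE. Qed.

Lemma qposetP (A : finType) (P Q : qposet A) : qle P =2 qle Q <-> P = Q.
Proof.
split=> [h|-> //]; apply/val_inj/setP => -[x y]; exact: h.
Qed.

Definition antisym (A : finType) (P : qposet A) : bool :=
  [forall x, forall y, qequiv P x y ==> (x == y)].

Fact qpull_refl (A B : finType) (f : B -> A) (P : qposet A) :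
  reflexive (fun x y => qle P (f x) (f y)).
Proof. by move=> x; apply: qle_refl. Qed.

Fact qpull_trans (A B : finType) (f : B -> A) (P : qposet A) :
  transitive (fun x y => qle P (f x) (f y)).
Proof. by move=> y x z; apply: qle_trans. Qed.

Definition qpull (A B : finType) (f : B -> A) (P : qposet A) : qposet B :=
  mkqposet (@qpull_refl A B f P) (@qpull_trans A B f P).

Lemma qpullE (A B : finType) (f : B -> A) (P : qposet A) x y :
  qle (qpull f P) x y = qle P (f x) (f y).
Proof. by rewrite mkqposetE. Qed.

(* [restr P B] is the restriction of P to B, transported to {0, ..., #|B|-1}
   along [enum_val]. For A = 'I_n, [enum_val] is the increasing bijection
   (lemma [enum_val_incr]), so that [restr P B] is Std(P_{|B}). *)
Definition restr (A : finType) (P : qposet A) (B : {set A}) :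
  qposet 'I_#|B| := qpull (fun i => enum_val i) P.

Lemma enum_val_incr n (B : {set 'I_n}) (i j : 'I_#|B|) :
  (i < j)%N -> (enum_val i < enum_val j)%N.
Proof.
move=> lt_ij; pose x0 := enum_val i.
have srt : sorted ltn (map val (enum B)).
  rewrite /(enum _) -enumT sorted_map.
  apply: sorted_filter; first by move=> y x z /=; apply: ltn_trans.
  by rewrite -sorted_map val_enum_ord iota_ltn_sorted.
have sz k : (k < #|B|)%N -> (k < size (enum B))%N by rewrite -cardE.
rewrite !(enum_val_nth x0) -!(nth_map x0 0%N val) ?sz //.
by apply: (sorted_ltn_nth ltn_trans) => //; rewrite inE size_map sz.
Qed.

Definition opens (A : finType) (P : qposet A) : {set {set A}} :=
  [set O : {set A} |
    [forall x, forall y, (x \in O) && qle P x y ==> (y \in O)]].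

Definition sum_rel (A B : finType) (P : qposet A) (Q : qposet B) :
  rel (A + B) := fun x y =>
  match x, y with
  | inl a, inl a' => qle P a a'
  | inr b, inr b' => qle Q b b'
  | _, _ => false
  end.

Fact sum_rel_refl (A B : finType) (P : qposet A) (Q : qposet B) :
  reflexive (sum_rel P Q).
Proof. by case=> x; apply: qle_refl. Qed.

Fact sum_rel_trans (A B : finType) (P : qposet A) (Q : qposet B) :
  transitive (sum_rel P Q).
Proof. by case=> y [x|x] [z|z] //=; apply: qle_trans. Qed.

Definition qsum (A B : finType) (P : qposet A) (Q : qposet B) :
  qposet (A + B)%type := mkqposet (@sum_rel_refl A B P Q) (@sum_rel_trans A B P Q).

(* [n] is encoded as 'I_n = {0, ..., n-1}. *)
Definition QP : Type := {n : nat & qposet 'I_n}.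
HB.instance Definition _ := Choice.on QP.

Definition QPof n (P : qposet 'I_n) : QP := Tagged (fun n => qposet 'I_n) P.

Definition QP1 : QP :=
  QPof (@mkqposet 'I_0 eq_op (@eqxx _) (@eq_op_trans _)).

Definition QPmul (P Q : QP) : QP :=
  QPof (qpull (fun i : 'I_(tag P + tag Q) => split i)
              (qsum (tagged P) (tagged Q))).

Definition nle (P : QP) (i j : nat) : bool :=
  match (insub i : option 'I_(tag P)), (insub j : option 'I_(tag P)) with
  | Some i', Some j' => qle (tagged P) i' j'
  | _, _ => false
  end.

Lemma nleE (P : QP) (i j : 'I_(tag P)) : nle P i j = qle (tagged P) i j.
Proof. by rewrite /nle !valK. Qed.

Lemma QP_eq (P Q : QP) : tag P = tag Q -> nle P =2 nle Q -> P = Q.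
Proof.
case: P Q => [n P] [m Q] /= enm; case: m / enm Q => Q h; congr existT.
by apply/qposetP => i j; have := h i j; rewrite !(@nleE (existT _ n _)).
Qed.

Lemma nle_dom (P : QP) i j : nle P i j -> (i < tag P)%N && (j < tag P)%N.
Proof. by rewrite /nle; do 2![case: insubP => [? -> _|//]]. Qed.

Lemma nle_mul (P Q : QP) i j : nle (QPmul P Q) i j =
  if (i < tag P)%N then (j < tag P)%N && nle P i j
  else (tag P <= j)%N && nle Q (i - tag P) (j - tag P).
Proof.
rewrite {1}/nle; case: insubP => /= [u _ eu|]; last first.
  rewrite -leqNgt => h; rewrite ltnNge (leq_trans (leq_addr _ _) h) /=.
  by apply/esym/negP => /andP[? /nle_dom]; lia.
case: insubP => /= [v _ ev|]; last first.
  rewrite -leqNgt => h; case: ifP => _; first by apply/esym/negP => /andP[]; lia.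
  by apply/esym/negP => /andP[? /nle_dom]; lia.
rewrite qpullE mkqposetE.
case: splitP => a /(etrans (esym eu)) ->; case: splitP => b /(etrans (esym ev)) -> /=;
  rewrite ?ltn_ord /=.
- by rewrite nleE.
- by rewrite ltnNge leq_addr.
- by rewrite ltnNge leq_addr /= leqNgt ltn_ord.
- by rewrite ltnNge !leq_addr /= !addKn nleE.
Qed.

Fact QPmulA : associative QPmul.
Proof.
move=> P Q R; apply: QP_eq => /= [|i j]; first by rewrite addnA.
rewrite !nle_mul /= -!subnDA.
case: (ltnP i (tag P)) => h1; case: (ltnP j (tag P)) => h2;
  case: (ltnP i (tag P + tag Q)) => h3; case: (ltnP j (tag P + tag Q)) => h4 //=;
  rewrite ?andbF //=; try lia.
all: have -> : (i - tag P < tag Q)%N = (i < tag P + tag Q)%N by lia.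
all: have -> : (j - tag P < tag Q)%N = (j < tag P + tag Q)%N by lia.
all: have -> : (tag Q <= j - tag P)%N = (tag P + tag Q <= j)%N by lia.
all: by rewrite ?h3 ?h4 1?ltnNge ?h3 ?h4 1?leqNgt ?h3 ?h4.
Qed.

Fact QPmul1m : left_id QP1 QPmul.
Proof.
move=> P; apply: QP_eq => //= i j; rewrite nle_mul ltn0 leq0n /=.
by rewrite !subn0.
Qed.

Fact QPmulm1 : right_id QP1 QPmul.
Proof.
move=> P; apply: QP_eq => /= [|i j]; first by rewrite addn0.
rewrite nle_mul; case: ltnP => h.
  by case hij: (nle P i j); rewrite ?andbF // andbT; have /andP[] := nle_dom hij.
rewrite [nle QP1 _ _](contraFF (@nle_dom _ _ _)) //= andbF.
by apply/esym/negP => /nle_dom; lia.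
Qed.

Lemma QP_tag0 (P : QP) : tag P = 0%N -> P = QP1.
Proof.
move=> h; apply: QP_eq => //= i j; transitivity false; last apply/esym.
  by apply/negP => /nle_dom; lia.
by apply/negP => /nle_dom.
Qed.

Fact QPunitm (P Q : QP) : QPmul P Q = QP1 -> P = QP1 /\ Q = QP1.
Proof.
move=> /(congr1 (@tag _ _)) /= /eqP; rewrite addn_eq0 => /andP[/eqP h1 /eqP h2].
by split; apply: QP_tag0.
Qed.

HB.instance Definition _ := Choice_isMonomialDef.Build QP
  QPmulA QPmul1m QPmulm1 QPunitm.

Definition qiso (A B : finType) (P : qposet A) (Q : qposet B) : bool :=
  [exists f : {ffun A -> B}, [&& injectiveb f, #|A| == #|B| &
    [forall x, forall y, qle P x y == qle Q (f x) (f y)]]].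

Lemma qisoP (A B : finType) (P : qposet A) (Q : qposet B) :
  reflect (exists2 f : A -> B, bijective f &
             forall x y, qle P x y = qle Q (f x) (f y))
          (qiso P Q).
Proof.
apply: (iffP existsP) => [[f /and3P[/injectiveP fi /eqP c h]]|[f fb h]].
  exists f; first by apply: inj_card_bij; rewrite ?c.
  by move=> x y; apply/eqP; move: x y; apply/'forall_forallP.
exists (finfun f); apply/and3P; split.
- by apply/injectiveP => x y; rewrite !ffunE; apply: bij_inj.
- by rewrite (bij_eq_card fb).
- by apply/'forall_forallP => x y; rewrite !ffunE h.
Qed.

Lemma qiso_refl (A : finType) (P : qposet A) : qiso P P.
Proof. by apply/qisoP; exists id => //; exists id. Qed.

Lemma qiso_sym (A B : finType) (P : qposet A) (Q : qposet B) :
  qiso P Q -> qiso Q P.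
Proof.
case/qisoP => f [g fK gK] h; apply/qisoP; exists g; first by exists f.
by move=> x y; rewrite h !gK.
Qed.

Lemma qiso_trans (A B C : finType) (P : qposet A) (Q : qposet B)
  (R : qposet C) : qiso P Q -> qiso Q R -> qiso P R.
Proof.
case/qisoP => f fb hf /qisoP[g gb hg]; apply/qisoP.
by exists (g \o f) => [|x y]; [apply: bij_comp|rewrite hf hg].
Qed.

Lemma qiso_pull (A B : finType) (f : B -> A) (P : qposet A) :
  bijective f -> qiso (qpull f P) P.
Proof. by move=> fb; apply/qisoP; exists f => // x y; rewrite qpullE. Qed.

Lemma qiso_sum (A B A' B' : finType) (P : qposet A) (Q : qposet B)
    (P' : qposet A') (Q' : qposet B') :
  qiso P P' -> qiso Q Q' -> qiso (qsum P Q) (qsum P' Q').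
Proof.
case/qisoP => f [f' fK f'K] hf /qisoP[g [g' gK g'K] hg]; apply/qisoP.
exists (fun x => match x with inl a => inl (f a) | inr b => inr (g b) end).
  exists (fun x => match x with inl a => inl (f' a) | inr b => inr (g' b) end);
    by case=> x; rewrite ?fK ?f'K ?gK ?g'K.
by case=> x [] y; rewrite !mkqposetE /=.
Qed.

Definition QPiso : rel QP := fun P Q => qiso (tagged P) (tagged Q).

Fact QPiso_sym : symmetric QPiso.
Proof. by move=> P Q; apply/idP/idP; apply: qiso_sym. Qed.

Fact QPiso_trans : transitive QPiso.
Proof. by move=> Q P R; apply: qiso_trans. Qed.

Canonical QPiso_equiv :=
  EquivRel QPiso (fun P => qiso_refl (tagged P)) QPiso_sym QPiso_trans.

(* Every finite quasi-poset is isomorphic to one in QP, so that isoclasses of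
   finite quasi-posets are the classes of QP modulo isomorphism. *)
Definition qp : Type := {eq_quot QPiso}.
HB.instance Definition _ := Choice.on qp.
HB.instance Definition _ := EqQuotient.on qp.

Definition isoclass (A : finType) (P : qposet A) : qp :=
  \pi_qp (QPof (qpull (@enum_val A A) P)).

Lemma isoclass_eq (A B : finType) (P : qposet A) (Q : qposet B) :
  isoclass P = isoclass Q <-> qiso P Q.
Proof.
have std (C : finType) (R : qposet C) : qiso (qpull (@enum_val C C) R) R.
  exact/qiso_pull/enum_val_bij.
split=> [/eqquotP h|h].
  exact: qiso_trans (qiso_sym (std _ P)) (qiso_trans h (std _ Q)).
by apply/eqquotP; apply: qiso_trans (std _ P) (qiso_trans h (qiso_sym (std _ Q))).
Qed.

Definition rep (c : qp) : QP := repr c.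

Lemma isoclass_rep (c : qp) : isoclass (tagged (rep c)) = c.
Proof.
rewrite -[RHS]reprK; apply/eqquotP; exact/qiso_pull/enum_val_bij.
Qed.

Lemma rep_iso (A : finType) (P : qposet A) : qiso (tagged (rep (isoclass P))) P.
Proof. by apply/isoclass_eq; rewrite isoclass_rep. Qed.

Definition qp1 : qp := isoclass (tagged QP1).

Definition qpmul (c d : qp) : qp :=
  isoclass (qsum (tagged (rep c)) (tagged (rep d))).

Lemma qpmulE (A B : finType) (P : qposet A) (Q : qposet B) :
  qpmul (isoclass P) (isoclass Q) = isoclass (qsum P Q).
Proof. by apply/isoclass_eq/qiso_sum; apply: rep_iso. Qed.

Lemma isoclass_QPmul (P Q : QP) :
  isoclass (tagged (QPmul P Q)) = qpmul (isoclass (tagged P)) (isoclass (tagged Q)).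
Proof.
by rewrite qpmulE; apply/isoclass_eq/qiso_pull; exists unsplit;
  [apply: splitK|apply: unsplitK].
Qed.

Fact qpmulA : associative qpmul.
Proof.
move=> c d e; rewrite -[c]isoclass_rep -[d]isoclass_rep -[e]isoclass_rep.
by rewrite -!isoclass_QPmul QPmulA.
Qed.

Fact qpmul1m : left_id qp1 qpmul.
Proof.
by move=> c; rewrite -[c]isoclass_rep -isoclass_QPmul QPmul1m.
Qed.

Fact qpmulm1 : right_id qp1 qpmul.
Proof.
by move=> c; rewrite -[c]isoclass_rep -isoclass_QPmul QPmulm1.
Qed.

Lemma isoclass_eq1 (P : QP) : isoclass (tagged P) = qp1 -> P = QP1.
Proof.
case/isoclass_eq/qisoP => f fb _; apply: QP_tag0.
by have := bij_eq_card fb; rewrite !card_ord.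
Qed.

Fact qpunitm (c d : qp) : qpmul c d = qp1 -> c = qp1 /\ d = qp1.
Proof.
rewrite -[c]isoclass_rep -[d]isoclass_rep -isoclass_QPmul.
by move/isoclass_eq1/QPunitm => [-> ->].
Qed.

HB.instance Definition _ := Choice_isMonomialDef.Build qp
  qpmulA qpmul1m qpmulm1 qpunitm.

Definition is_poset_class (c : qp) : bool := antisym (tagged (rep c)).

Lemma antisym_iso (A B : finType) (P : qposet A) (Q : qposet B) :
  qiso P Q -> antisym P = antisym Q.
Proof.
have imp (C D : finType) (R : qposet C) (S : qposet D) :
    qiso R S -> antisym R -> antisym S.
  case/qiso_sym/qisoP => f fb h /'forall_'forall_implyP hR.
  apply/'forall_'forall_implyP => x y; rewrite /qequiv !h => /hR /eqP /(bij_inj fb) ->.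
  by [].
by move=> h; apply/idP/idP; apply: imp => //; apply: qiso_sym.
Qed.

Lemma is_poset_classE (A : finType) (P : qposet A) :
  is_poset_class (isoclass P) = antisym P.
Proof. exact/antisym_iso/rep_iso. Qed.

Definition posetclass : Type := {c : qp | is_poset_class c}.
HB.instance Definition _ := Choice.on posetclass.
HB.instance Definition _ := SubType.on posetclass.

Lemma antisym_sum (A B : finType) (P : qposet A) (Q : qposet B) :
  antisym P -> antisym Q -> antisym (qsum P Q).
Proof.
move=> /'forall_'forall_implyP hP /'forall_'forall_implyP hQ.
apply/'forall_'forall_implyP => -[] x [] y; rewrite /qequiv !mkqposetE //=.
  by move/hP/eqP ->.
by move/hQ/eqP ->.
Qed.

Lemma antisym_restr (A : finType) (P : qposet A) (B : {set A}) :
  antisym P -> antisym (restr P B).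
Proof.
move=> /'forall_'forall_implyP hP; apply/'forall_'forall_implyP => i j.
by rewrite /qequiv !qpullE => /hP /eqP /enum_val_inj ->.
Qed.

Fact pclass_subproof (A : finType) (P : qposet A) :
  antisym P -> is_poset_class (isoclass P).
Proof. by rewrite is_poset_classE. Qed.

Definition pclass (A : finType) (P : qposet A) (hP : antisym P) : posetclass :=
  Sub (isoclass P) (pclass_subproof hP).

Fact antisym_QP1 : antisym (tagged QP1).
Proof. by apply/forallP => -[]. Qed.

Definition p1 : posetclass := pclass antisym_QP1.

Definition pmul (c d : posetclass) : posetclass :=
  pclass (antisym_sum (valP c) (valP d)).

Lemma val_pmul (c d : posetclass) : val (pmul c d) = qpmul (val c) (val d).
Proof. by []. Qed.

Fact pmulA : associative pmul.
Proof. by move=> c d e; apply: val_inj; rewrite !val_pmul qpmulA. Qed.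

Fact pmul1m : left_id p1 pmul.
Proof. by move=> c; apply: val_inj; rewrite val_pmul qpmul1m. Qed.

Fact pmulm1 : right_id p1 pmul.
Proof. by move=> c; apply: val_inj; rewrite val_pmul qpmulm1. Qed.

Fact punitm (c d : posetclass) : pmul c d = p1 -> c = p1 /\ d = p1.
Proof.
by move=> /(congr1 val) /qpunitm[h1 h2]; split; apply: val_inj.
Qed.

HB.instance Definition _ := Choice_isMonomialDef.Build posetclass
  pmulA pmul1m pmulm1 punitm.

(* [k] is encoded as 'I_k = {0, ..., k-1}. *)
Definition Lset (A : finType) (P : qposet A) (k : nat) :
    {set {ffun A -> 'I_k}} :=
  [set f : {ffun A -> 'I_k} | [forall i, forall j, qle P i j ==> (f i <= f j)%N]].

Definition Lstr (A : finType) (P : qposet A) (k : nat) :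
    {set {ffun A -> 'I_k}} :=
  [set f in Lset P k | [forall i, forall j,
     qle P i j && (f i == f j) ==> qequiv P i j]].

Lemma poly_nat_inj (R : numDomainType) (p q : {poly R}) :
  (forall k : nat, p.[k%:R] = q.[k%:R]) -> p = q.
Proof.
move=> h; apply/eqP; rewrite -subr_eq0; apply/negPn/negP => nz.
pose s : seq R := [seq i%:R | i <- iota 0 (size (p - q))].
have := @max_poly_roots _ (p - q) s nz; rewrite size_map size_iota ltnn => F.
suff : false by []; apply: F.
  by apply/allP => _ /mapP[i _ ->]; rewrite rootE !hornerE h subrr.
by rewrite map_inj_uniq ?iota_uniq // => i j /eqP; rewrite Num.Theory.eqr_nat => /eqP.
Qed.

Definition binpoly (j : nat) : {poly rat} :=
  (j`!%:R^-1) *: \prod_(i < j) ('X - i%:R%:P).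

Lemma binpolyE j k : (binpoly j).[k%:R] = 'C(k, j)%:R.
Proof.
have nz : j`!%:R != 0 :> rat by rewrite Num.Theory.pnatr_eq0 -lt0n fact_gt0.
apply: (mulfI nz); rewrite hornerZ mulrA divff // mul1r -natrM mulnC bin_ffact.
rewrite horner_prod; under eq_bigr do rewrite !hornerE.
case: (leqP j k) => h; last first.
  by rewrite ffact_small // (bigD1 (Ordinal h)) //= subrr mul0r.
rewrite ffact_prod natr_prod; apply: eq_bigr => i _.
by rewrite natrB // (leq_trans (ltnW (ltn_ord i))).
Qed.

(* A family of sets of maps A -> 'I_k that is stable under strictly increasing
   relabelling of the values is counted by a polynomial in k. *)
Lemma count_poly (A : finType) (L : forall k, {set {ffun A -> 'I_k}}) :
  (forall j k (e : 'I_j -> 'I_k) (f : {ffun A -> 'I_j}),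
     (forall x y : 'I_j, (x < y)%N -> (e x < e y)%N) ->
     ([ffun a => e (f a)] \in L k) = (f \in L j)) ->
  {p : {poly rat} | forall k : nat, p.[k%:R] = #|L k|%:R}.
Proof.
move=> stab.
pose s j := #|[set f in L j | [set f a | a in A] == [set: 'I_j]]|.
exists (\sum_(j < #|A|.+1) (s j)%:R *: binpoly j) => k.
have cnt (B : {set 'I_k}) :
    #|[set f in L k | [set f a | a in A] == B]| = s #|B|.
  pose up (f : {ffun A -> 'I_#|B|}) : {ffun A -> 'I_k} := [ffun a => enum_val (f a)].
  have upi : injective up.
    by move=> f g /ffunP h; apply/ffunP => a; have := h a; rewrite !ffunE => /enum_val_inj.
  rewrite /s -(card_imset _ upi); apply: eq_card => g; rewrite !inE.
  have stB := stab _ _ _ _ (@enum_val_incr _ B).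
  apply/andP/imsetP => [[gL /eqP gB]|[f]]; last first.
    rewrite inE => /andP[fL /eqP fB] ->; rewrite stB fL; split=> //; apply/eqP/setP => x.
    apply/imsetP/idP => [[a _ ->]|xB]; first by rewrite ffunE enum_valP.
    have : enum_rank_in xB x \in [set: 'I_#|B|] by rewrite inE.
    rewrite -fB => /imsetP[a _ ea]; exists a => //.
    by rewrite ffunE -ea enum_rankK_in.
  have gin a : g a \in B by rewrite -gB; apply/imsetP; exists a.
  pose f : {ffun A -> 'I_#|B|} := [ffun a => enum_rank_in (gin a) (g a)].
  have ef : g = up f by apply/ffunP => a; rewrite !ffunE enum_rankK_in.
  exists f => //; rewrite inE -stB -/(up f) -ef gL /=; apply/eqP/setP => y.
  rewrite inE; apply/imsetP.
  have : enum_val y \in [set g a | a in A] by rewrite gB enum_valP.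
  case/imsetP=> a _ ea.
  by exists a => //; apply: enum_val_inj; rewrite ffunE enum_rankK_in.
have s0 j : (#|A| < j)%N -> s j = 0%N.
  move=> h; apply/eqP; rewrite cards_eq0; apply/eqP/setP => f; rewrite !inE.
  apply/negP => /andP[_ /eqP e]; move: (leq_imset_card f A).
  by rewrite e cardsT card_ord leqNgt h.
have -> : #|L k| = \sum_(B : {set 'I_k}) s #|B|.
  rewrite -sum1_card (partition_big (fun f : {ffun A -> 'I_k} => [set f a | a in A]) xpredT) //=.
  by apply: eq_bigr => B _; rewrite -cnt -sum1_card; apply: eq_bigl => f; rewrite !inE.
have -> : (\sum_(B : {set 'I_k}) s #|B| = \sum_(j < k.+1) s j * 'C(k, j))%N.
  rewrite (partition_big (fun B : {set 'I_k} => inord #|B| : 'I_k.+1) xpredT) //=.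
  apply: eq_bigr => j _.
  have eB (B : {set 'I_k}) : (inord #|B| == j :> 'I_k.+1) = (#|B| == j).
    rewrite -val_eqE /= inordK // ltnS; have := max_card (mem B); by rewrite card_ord.
  rewrite (eq_bigl _ _ eB) (eq_bigr (fun=> s j)); last by move=> B /eqP ->.
  rewrite sum_nat_const mulnC; congr muln.
  have := card_draws 'I_k j; rewrite card_ord => <-; by apply: eq_card => B; rewrite !inE.
rewrite horner_sum.
under eq_bigr do rewrite hornerZ binpolyE -natrM.
rewrite -natr_sum; congr (_%:R).
have wid m n : (m <= n)%N -> (forall j, (m < j)%N -> (s j * 'C(k, j) = 0)%N) ->
    (\sum_(j < m.+1) s j * 'C(k, j) = \sum_(j < n.+1) s j * 'C(k, j))%N.
  move=> le_mn z; rewrite -!(big_mkord xpredT (fun j => s j * 'C(k, j))%N).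
  rewrite [RHS](@big_cat_nat _ _ _ m.+1) //= [X in (_ + X)%N]big_nat_cond.
  by rewrite [X in (_ + X)%N]big1 ?addn0 // => j /andP[/andP[/z -> _] _].
transitivity (\sum_(j < (#|A| + k).+1) s j * 'C(k, j))%N.
  by apply: wid => [|j /s0 ->]; rewrite ?leq_addr.
by apply/esym/wid => [|j h]; rewrite ?leq_addl // bin_small ?muln0.
Qed.

Fact ehr_exists (A : finType) (P : qposet A) :
  {p : {poly rat} | forall k : nat, p.[k%:R] = #|Lset P k|%:R}.
Proof.
apply: count_poly => j k e f he; rewrite !inE; apply: eq_forallb => x.
apply: eq_forallb => y; rewrite !ffunE; congr (_ ==> _).
by case: (ltngtP (f x) (f y)) => [/he/ltnW h|/he h|/val_inj ->];
  rewrite ?leqnn ?h // leqNgt h.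
Qed.

Fact ehrstr_exists (A : finType) (P : qposet A) :
  {p : {poly rat} | forall k : nat, p.[k%:R] = #|Lstr P k|%:R}.
Proof.
apply: count_poly => j k e f he.
have ei : injective e.
  move=> x y h; apply: val_inj.
  by case: (ltngtP x y) => // /he; rewrite h ltnn.
rewrite !inE; congr (_ && _); apply: eq_forallb => x; apply: eq_forallb => y;
  rewrite !ffunE; last by rewrite (inj_eq ei).
congr (_ ==> _).
by case: (ltngtP (f x) (f y)) => [/he/ltnW h|/he h|/val_inj ->];
  rewrite ?leqnn ?h // leqNgt h.
Qed.

Definition ehr (A : finType) (P : qposet A) : {poly rat} :=
  sval (ehr_exists P).

Definition ehrstr (A : finType) (P : qposet A) : {poly rat} :=
  sval (ehrstr_exists P).

Lemma ehrP (A : finType) (P : qposet A) (p : {poly rat}) :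
  (forall k : nat, p.[k%:R] = #|Lset P k|%:R) <-> p = ehr P.
Proof.
split=> [h|-> k]; last exact: (svalP (ehr_exists P)).
by apply: poly_nat_inj => k; rewrite h (svalP (ehr_exists P)).
Qed.

Lemma ehrstrP (A : finType) (P : qposet A) (p : {poly rat}) :
  (forall k : nat, p.[k%:R] = #|Lstr P k|%:R) <-> p = ehrstr P.
Proof.
split=> [h|-> k]; last exact: (svalP (ehrstr_exists P)).
by apply: poly_nat_inj => k; rewrite h (svalP (ehrstr_exists P)).
Qed.

Lemma ehr_iso (A B : finType) (P : qposet A) (Q : qposet B) :
  qiso P Q -> ehr P = ehr Q /\ ehrstr P = ehrstr Q.
Proof.
case/qisoP => f [g fK gK] h.
have hg x y : qle Q x y = qle P (g x) (g y) by rewrite h !gK.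
pose up k (u : {ffun B -> 'I_k}) : {ffun A -> 'I_k} := [ffun a => u (f a)].
have upb k : bijective (@up k).
  exists (fun v : {ffun A -> 'I_k} => [ffun b => v (g b)]) => u;
    by apply/ffunP => x; rewrite !ffunE ?gK ?fK.
have fa (p : rel A) : [forall x, forall y, p x y] = [forall x, forall y, p (g x) (g y)].
  apply/'forall_forallP/'forall_forallP => hp x y; first exact: hp.
  by have := hp (f x) (f y); rewrite !fK.
have hL k u : (up k u \in Lset P k) = (u \in Lset Q k).
  rewrite !inE fa; apply: eq_forallb => x; apply: eq_forallb => y.
  by rewrite !ffunE !gK hg.
have hS k u : (up k u \in Lstr P k) = (u \in Lstr Q k).
  rewrite [LHS]in_set [RHS]in_set hL; congr (_ && _).
  rewrite fa; apply: eq_forallb => x; apply: eq_forallb => y.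
  by rewrite /qequiv !ffunE !gK !hg.
split; [apply/ehrP => k; rewrite (ehrP P _).2 //
       |apply/ehrstrP => k; rewrite (ehrstrP P _).2 //]; congr (_%:R).
- rewrite -(on_card_preimset (onW_bij _ (upb k))); apply: eq_card => u.
  by rewrite inE hL.
- rewrite -(on_card_preimset (onW_bij _ (upb k))); apply: eq_card => u.
  by rewrite inE hS.
Qed.

(* The vector space with basis B is {malg K[B]}; when B is a monoid, the
   product of {malg K[B]} is the bilinear extension of that of B. The tensor
   square of {malg K[B]} is {malg K[B * B]}, with pure tensors [tens x y]. *)
Section Hopf.
Variable K : fieldType.

Definition linext (B : choiceType) (V : lmodType K) (h : B -> V)
    (x : {malg K[B]}) : V :=
  \sum_(b <- msupp x) x@_b *: h b.

Lemma linextEw (B : choiceType) (V : lmodType K) (h : B -> V)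
    (d : {fset B}) (x : {malg K[B]}) : (msupp x `<=` d)%fset ->
  linext h x = \sum_(b <- d) x@_b *: h b.
Proof.
move=> le_d; rewrite [LHS](big_fset_incl _ le_d) => //= b _ /mcoeff_outdom ->.
by rewrite scale0r.
Qed.

Lemma linext_linear (B : choiceType) (V : lmodType K) (h : B -> V) :
  linear (linext h).
Proof.
move=> a x y; pose d := (msupp (a *: x + y) `|` (msupp x `|` msupp y))%fset.
have [d1 d2] : (msupp x `<=` d)%fset /\ (msupp y `<=` d)%fset.
  by rewrite /d; split; apply: fsubsetU; rewrite ?fsubsetUl ?fsubsetUr orbT.
rewrite (linextEw h (fsubsetUl _ _ : (_ `<=` d)%fset)) (linextEw h d1) (linextEw h d2).
rewrite scaler_sumr -big_split /=; apply: eq_bigr => b _.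
by rewrite mcoeffD mcoeffZ scalerDl scalerA.
Qed.

HB.instance Definition _ (B : choiceType) (V : lmodType K) (h : B -> V) :=
  GRing.isLinear.Build K {malg K[B]} V *:%R (linext h) (linext_linear h).

Lemma linextU (B : choiceType) (V : lmodType K) (h : B -> V) (b : B) :
  linext h << b >> = h b.
Proof.
by rewrite (@linextEw _ _ h [fset b]%fset) ?msuppU_le // big_seq_fset1 mcoeffUU scale1r.
Qed.

Definition tens (B : choiceType) (x y : {malg K[B]}) : {malg K[(B * B)%type]} :=
  \sum_(a <- msupp x) \sum_(b <- msupp y) << x@_a * y@_b *g (a, b) >>.

(* K[X] (x) K[X] is the ring of bivariate polynomials: X (x) 1 is 'X and
   1 (x) X is 'Y, so that the coproduct of K[X] is p |-> p('X + 'Y), which is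
   [poly_XaY]; its counit is p |-> p(0) and its antipode p |-> p(- X). *)
Definition polytens (p q : {poly K}) : {poly {poly K}} := p^:P * q%:P.

Lemma poly_antipode (p : {poly K}) :
  (poly_XaY p \Po - 'X).['X] = (p.[0])%:P /\
  (poly_XaY p).[- 'X] = (p.[0])%:P.
Proof.
rewrite /poly_XaY; split; rewrite !horner_comp !hornerE ?addNr;
  by rewrite -[0 in LHS]polyC0 horner_map.
Qed.

(* f (x) f, computed on the basis *)
Definition tensmap (B : choiceType) (f : {malg K[B]} -> {poly K})
    (u : {malg K[(B * B)%type]}) : {poly {poly K}} :=
  mmap (polyC \o polyC) (fun c => polytens (f << c.1 >>) (f << c.2 >>)) u.

Lemma tensmap_tens (B : choiceType) (f : {malg K[B]} -> {poly K}) :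
  linear f -> forall x y, tensmap f (tens x y) = polytens (f x) (f y).
Proof.
move=> flin x y.
pose F : {linear {malg K[B]} -> {poly K}} :=
  HB.pack f (GRing.isLinear.Build _ _ _ _ f flin).
have fE z : f z = \sum_(a <- msupp z) z@_a *: f << a >>.
  rewrite {1}[z]monalgE -[f]/(F : _ -> _) linear_sum; apply: eq_bigr => a _.
  by rewrite -linearZ; congr (F _); apply/malgP => b; rewrite mcoeffZ !mcoeffU mulrnAr mulr1.
rewrite /tensmap /tens raddf_sum /polytens [f x in RHS]fE [f y in RHS]fE.
rewrite !raddf_sum /= mulr_suml; apply: eq_bigr => a _.
rewrite raddf_sum mulr_sumr; apply: eq_bigr => b _.
rewrite [LHS]mmapU /= -!mul_polyC !rmorphM /= map_polyC /=.
by rewrite mulrACA.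
Qed.

Definition counit (B : monomType) (x : {malg K[B]}) : K := x@_(mone : B).

(* [cop] is the coproduct of {malg K[B]}, given on the basis B *)
Definition is_antipode (B : monomType) (cop : B -> {malg K[(B * B)%type]})
    (S : {malg K[B]} -> {malg K[B]}) : Prop :=
  linear S /\ forall x,
    linext (fun c => S << c.1 >> * << c.2 >>) (linext cop x) = (counit x)%:A /\
    linext (fun c => << c.1 >> * S << c.2 >>) (linext cop x) = (counit x)%:A.

Record hopf_morphism (B : monomType) (cop : B -> {malg K[(B * B)%type]})
    (f : {malg K[B]} -> {poly K}) : Prop := HopfMorphism {
  hopf_morphism_linear : linear f;
  hopf_morphism_alg : monoid_morphism f;
  hopf_morphism_counit : forall x, (f x).[0] = counit x;
  hopf_morphism_cop : forall x, poly_XaY (f x) = tensmap f (linext cop x);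
  hopf_morphism_antipode : forall S, is_antipode cop S ->
    forall x, f (S x) = f x \Po (- 'X) }.

Definition copQP (P : QP) : {malg K[(QP * QP)%type]} :=
  \sum_(O in opens (tagged P))
    << (QPof (restr (tagged P) (~: O)), QPof (restr (tagged P) O)) >>.

Definition copqp (c : qp) : {malg K[(qp * qp)%type]} :=
  let P := tagged (rep c) in
  \sum_(O in opens P) << (isoclass (restr P (~: O)), isoclass (restr P O)) >>.

Lemma qiso_restr (A B : finType) (P : qposet A) (Q : qposet B) (f : A -> B)
    (O : {set B}) : bijective f -> (forall x y, qle P x y = qle Q (f x) (f y)) ->
  qiso (restr P (f @^-1: O)) (restr Q O).
Proof.
move=> fb h; have c : #|f @^-1: O| = #|O|.
  exact/on_card_preimset/onW_bij.
have fin (i : 'I_#|f @^-1: O|) : f (enum_val i) \in O.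
  by have := enum_valP i; rewrite inE.
apply/qisoP; exists (fun i => enum_rank_in (fin i) (f (enum_val i))).
  apply: inj_card_bij; last by rewrite !card_ord c.
  move=> i j /(congr1 enum_val); rewrite !enum_rankK_in //.
  by move/(bij_inj fb)/enum_val_inj.
by move=> i j; rewrite !qpullE !enum_rankK_in // h.
Qed.

Lemma copqp_isoclass (A : finType) (P : qposet A) :
  copqp (isoclass P) =
  \sum_(O in opens P) << (isoclass (restr P (~: O)), isoclass (restr P O)) >>.
Proof.
rewrite /copqp; case/qisoP: (rep_iso P) => f fb h; have [g fK gK] := fb.
rewrite (reindex (fun O : {set A} => f @^-1: O)) /=; last first.
  apply: onW_bij; exists (fun O : {set _} => g @^-1: O) => O;
    by apply/setP => x; rewrite !inE ?gK ?fK.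
apply: eq_big => [O|O _].
  rewrite !inE; apply/'forall_'forall_implyP/'forall_'forall_implyP => hO x y.
    by have := hO (g x) (g y); rewrite !inE h !gK.
  by rewrite !inE h; apply: hO.
have E := fun O => (isoclass_eq _ _).2 (@qiso_restr _ _ _ _ f O fb h).
by rewrite -preimsetC !E.
Qed.

Definition copp (c : posetclass) : {malg K[(posetclass * posetclass)%type]} :=
  let P := tagged (rep (val c)) in
  \sum_(O in opens P) << (pclass (antisym_restr (~: O) (valP c)),
                          pclass (antisym_restr O (valP c))) >>.

(* the coproduct of H_p is the restriction of that of H_qp *)
Lemma copp_val (c : posetclass) :
  linext (fun d => << (val d.1, val d.2) >>) (copp c) = copqp (val c).
Proof. by rewrite linear_sum; apply: eq_bigr => O _; rewrite [LHS]linextU. Qed.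

Definition ehrQP : {malg K[QP]} -> {poly K} :=
  linext (fun P : QP => map_poly ratr (ehr (tagged P))).

Definition ehrstrQP : {malg K[QP]} -> {poly K} :=
  linext (fun P : QP => map_poly ratr (ehrstr (tagged P))).

Definition ehrqp : {malg K[qp]} -> {poly K} :=
  linext (fun c : qp => map_poly ratr (ehr (tagged (rep c)))).

Definition ehrstrqp : {malg K[qp]} -> {poly K} :=
  linext (fun c : qp => map_poly ratr (ehrstr (tagged (rep c)))).

Definition ehrp : {malg K[posetclass]} -> {poly K} :=
  linext (fun c : posetclass => map_poly ratr (ehr (tagged (rep (val c))))).

Definition ehrstrp : {malg K[posetclass]} -> {poly K} :=
  linext (fun c : posetclass => map_poly ratr (ehrstr (tagged (rep (val c))))).

Lemma ehrqp_isoclass (A : finType) (P : qposet A) :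
  ehrqp << isoclass P >> = map_poly ratr (ehr P) /\
  ehrstrqp << isoclass P >> = map_poly ratr (ehrstr P).
Proof. by rewrite /ehrqp /ehrstrqp !linextU; case: (ehr_iso (rep_iso P)) => -> ->. Qed.

End Hopf.

(* Main.v *)
Require Import Defs.
From mathcomp Require Import all_boot all_order all_algebra.
From HB Require Import structures.
From mathcomp Require Import zify finmap ring.
From mathcomp.multinomials Require Import monalg.

Set Implicit Arguments.
Unset Strict Implicit.
Unset Printing Implicit Defensive.

Import GRing.Theory.

Local Open Scope ring_scope.
Local Open Scope quotient_scope.

(** A polynomial over a field of characteristic zero is determined by its
values at the natural numbers, and a bivariate one by its values at the pairs
of natural numbers. The compatibility with products and coproducts is thus a
statement about numbers of labelings.

- Labelings of a disjoint union are pairs of labelings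
  ([card_labelings_sum]), whence multiplicativity.
- The coproduct of K[X] evaluated at (k, l) gives the value at k + l. Cut a
  labeling of P with values in [k + l] at height k: the elements with a label
  above the cut form an open set O, the labels below the cut form a labeling
  of the restriction of P to the complement of O in [k], the labels above it,
  shifted down, form a labeling of the restriction to O in [l], and O and the
  two labelings may be prescribed freely ([card_labelings_cut],
  [card_labelingsD]). No condition is lost between the two parts, as a strict
  inequality of labels satisfies both the weak and the strict requirement.
- At k = 0 only the empty quasi-poset has a labeling, whence the counit.

The antipode comes for free from connectedness. In the coproduct of a basis
element b there is one term b (x) 1, and the left factors of all others are
smaller than b. If f is compatible with products, coproducts and counits, then
f o S and b |-> (f b)(- X) are both left convolution inverses of f; this
identity, read at b, determines the value of the left inverse at b from its
values at smaller elements, so the two agree by induction on the size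
([hopf_morphism_linext]).

The three algebras only differ in how a basis element b is attached to a
quasi-poset; [hopf_morphism_ehr] treats them, and the two kinds of labelings,
at once. *)

(** * Evaluation at natural numbers in characteristic zero *)

Lemma pchar0_intr_eq0 (F : fieldType) (charF : [pchar F] =i pred0) (z : int) :
  (z%:~R == 0 :> F) = (z == 0).
Proof.
by rewrite [z]intEsign rmorphM /= rmorph_sign !mulf_eq0 !signr_eq0 /= (pcharf0P F).1.
Qed.

(** Nonzero integers stay nonzero in F, which justifies cross-multiplication;
hence [ratr] may be computed on any fraction, reduced or not, and this makes it
a ring morphism. *)
Lemma pchar0_ratr_frac (F : fieldType) (charF : [pchar F] =i pred0)
    (n d : int) : d != 0 -> ratr (n%:~R / d%:~R) = n%:~R / d%:~R :> F.
Proof.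
move=> d0; set x := (n%:~R / d%:~R : rat).
have nz (z : int) : z != 0 -> z%:~R != 0 :> F by rewrite pchar0_intr_eq0.
have e : (numq x * d = n * denq x)%R.
  apply: (@intr_inj rat); rewrite !rmorphM /=.
  apply/eqP; rewrite -eqr_div ?intr_eq0 ?denq_eq0 //; apply/eqP.
  by rewrite divq_num_den.
apply/eqP; rewrite /ratr eqr_div ?nz ?denq_neq0 //.
by rewrite -!rmorphM /= e.
Qed.

Lemma pchar0_ratr_zmod (F : fieldType) (charF : [pchar F] =i pred0) :
  zmod_morphism (@ratr F).
Proof.
move=> x y; have nz (z : rat) : (denq z)%:~R != 0 :> F.
  by rewrite pchar0_intr_eq0 ?denq_neq0.
have nzQ (z : rat) : (denq z)%:~R != 0 :> rat by rewrite intr_eq0 denq_neq0.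
have -> : x - y = (numq x * denq y - numq y * denq x)%:~R / (denq x * denq y)%:~R.
  rewrite -{1}[x]divq_num_den -{1}[y]divq_num_den !rmorphB !rmorphM /=.
  by field; rewrite !nzQ.
rewrite pchar0_ratr_frac ?mulf_neq0 ?denq_neq0 // /ratr !rmorphB !rmorphM /=.
by field; rewrite !nz.
Qed.

Lemma pchar0_ratr_monoid (F : fieldType) (charF : [pchar F] =i pred0) :
  monoid_morphism (@ratr F).
Proof.
split=> [|x y]; first exact: (ratr_nat F 1).
have nz (z : rat) : (denq z)%:~R != 0 :> F.
  by rewrite pchar0_intr_eq0 ?denq_neq0.
have nzQ (z : rat) : (denq z)%:~R != 0 :> rat by rewrite intr_eq0 denq_neq0.
have -> : x * y = (numq x * numq y)%:~R / (denq x * denq y)%:~R.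
  by rewrite !rmorphM /= -mulf_div !divq_num_den.
by rewrite pchar0_ratr_frac ?mulf_neq0 ?denq_neq0 // /ratr !rmorphM /= mulf_div.
Qed.

Lemma horner_ratr_nat (F : fieldType) (charF : [pchar F] =i pred0)
    (p : {poly rat}) (k m : nat) :
  p.[k%:R] = m%:R -> (map_poly ratr p).[k%:R] = m%:R :> F.
Proof.
move=> e.
pose g : {rmorphism rat -> F} := HB.pack (@ratr F)
  (GRing.isZmodMorphism.Build _ _ _ (pchar0_ratr_zmod charF))
  (GRing.isMonoidMorphism.Build _ _ _ (pchar0_ratr_monoid charF)).
rewrite -[map_poly _ _]/(map_poly g p) -(rmorph_nat g k) horner_map e.
exact: rmorph_nat.
Qed.

Lemma pchar0_poly_nat_inj (R : idomainType) (charR : [pchar R] =i pred0)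
    (p q : {poly R}) : (forall k : nat, p.[k%:R] = q.[k%:R]) -> p = q.
Proof.
move=> pq; apply/eqP; rewrite -subr_eq0; apply/negPn/negP => nz.
pose s : seq R := [seq i%:R | i <- iota 0 (size (p - q))].
suff: (size s < size (p - q)%R)%N by rewrite size_map size_iota ltnn.
apply: (max_poly_roots nz).
  by apply/allP => _ /mapP[i _ ->]; rewrite rootE !hornerE pq subrr.
rewrite map_inj_uniq ?iota_uniq // => i j.
wlog le_ij : i j / (i <= j)%N => [th|] eij.
  by case/orP: (leq_total i j) => /th; [exact|move=> h; exact/esym/h].
have /eqP : (j - i)%:R = 0 :> R by rewrite natrB // eij subrr.
by rewrite (pcharf0P R).1 // subn_eq0 => ji; apply/eqP; rewrite eqn_leq le_ij.
Qed.

Lemma pchar0_poly2_nat_inj (R : idomainType) (charR : [pchar R] =i pred0)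
    (u v : {poly {poly R}}) :
  (forall k l : nat, u.[k%:R].[l%:R] = v.[k%:R].[l%:R]) -> u = v.
Proof.
move=> uv; apply: pchar0_poly_nat_inj => [i|k].
  by rewrite pchar_poly charR.
exact: pchar0_poly_nat_inj.
Qed.

(** * Counting labelings *)

Section Labelings.
Local Open Scope nat_scope.
Variable strict : bool.

(** The weak and the strict labelings are put in a common form, a disjunction
in which a strict inequality of labels always suffices; only this part of the
condition is at stake between labels on the two sides of a cut. *)
Definition label_ok (A : finType) (P : qposet A) k (f : A -> 'I_k) x y :=
  qle P x y ==> (f x < f y) || (f x == f y) && (strict ==> qle P y x).

Definition labelings (A : finType) (P : qposet A) (k : nat) :
    {set {ffun A -> 'I_k}} :=
  [set f : {ffun A -> 'I_k} | [forall x, forall y, label_ok P f x y]].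

Definition ehrhart (A : finType) (P : qposet A) : {poly rat} :=
  if strict then ehrstr P else ehr P.

Lemma labelingsE (A : finType) (P : qposet A) (k : nat) :
  labelings P k = if strict then Lstr P k else Lset P k.
Proof.
rewrite /labelings /label_ok; case: strict; apply/setP => f; last first.
  rewrite !inE; apply: eq_forallb => x; apply: eq_forallb => y.
  by rewrite /= andbT [(f x <= f y) in RHS]leq_eqVlt orbC.
rewrite !inE; apply/'forall_forallP/andP => [h|[/'forall_forallP h1 /'forall_forallP h2] x y].
  split; apply/'forall_forallP => x y; have := h x y; rewrite /qequiv /=.
    by case: (qle P x y) => //= /orP[/ltnW|/andP[/eqP-> _]].
  case: (qle P x y) => //= /orP[lt_f|/andP[_ ->]]; last by rewrite implybT.
  by apply/implyP => /eqP e; rewrite e ltnn in lt_f.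
have := h1 x y; have := h2 x y; rewrite /qequiv /=.
case: (qle P x y) => //=; rewrite -val_eqE /= => h; rewrite leq_eqVlt orbC.
by case/orP => [->//|e]; move: h; rewrite e orbC /= => ->.
Qed.

Lemma ehrhart_nat (A : finType) (P : qposet A) k :
  (ehrhart P).[k%:R] = #|labelings P k|%:R%R.
Proof.
rewrite labelingsE /ehrhart; case: strict.
  exact: (ehrstrP P _).2.
exact: (ehrP P _).2.
Qed.

Lemma ehrhart_iso (A B : finType) (P : qposet A) (Q : qposet B) :
  qiso P Q -> ehrhart P = ehrhart Q.
Proof. by rewrite /ehrhart => /ehr_iso[-> ->]. Qed.

Lemma card_labelings_iso (A B : finType) (P : qposet A) (Q : qposet B) k :
  qiso P Q -> #|labelings P k| = #|labelings Q k|.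
Proof.
move=> /ehrhart_iso e; apply/eqP; rewrite -(Num.Theory.eqr_nat rat).
by rewrite -!ehrhart_nat e.
Qed.

Lemma card_labelings0 (A : finType) (P : qposet A) :
  #|A| = 0 -> forall k, #|labelings P k| = 1.
Proof.
move=> A0 k; transitivity #|{ffun A -> 'I_k}|; last by rewrite card_ffun A0.
apply: eq_card => f; rewrite !inE; apply/'forall_forallP => x.
by have := card0_eq A0 x; rewrite inE.
Qed.

Lemma card_labelings_at0 (A : finType) (P : qposet A) :
  #|labelings P 0| = (#|A| == 0).
Proof.
case: eqP => [A0|/eqP A0]; first exact: card_labelings0.
apply/eqP; rewrite -leqn0 (leq_trans (max_card _)) //.
by rewrite card_ffun card_ord exp0n // lt0n.
Qed.

Lemma card_labelings_sum (A B : finType) (P : qposet A) (Q : qposet B) k :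
  #|labelings (qsum P Q) k| = #|labelings P k| * #|labelings Q k|.
Proof.
pose cp (gh : {ffun A -> 'I_k} * {ffun B -> 'I_k}) : {ffun A + B -> 'I_k} :=
  [ffun c => match c with inl a => gh.1 a | inr b => gh.2 b end].
have cp_bij : bijective cp.
  exists (fun f : {ffun A + B -> 'I_k} => ([ffun a => f (inl a)], [ffun b => f (inr b)])).
    by move=> [g h]; congr pair; apply/ffunP => x; rewrite !ffunE.
  by move=> f; apply/ffunP => -[] x; rewrite !ffunE.
rewrite -cardsX -(on_card_preimset (onW_bij _ cp_bij)); apply: eq_card => gh.
rewrite !inE; apply/'forall_forallP/andP => [h|].
  split; apply/'forall_forallP => x y.
    by have := h (inl x) (inl y); rewrite /label_ok !mkqposetE /= !ffunE.
  by have := h (inr x) (inr y); rewrite /label_ok !mkqposetE /= !ffunE.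
move=> [/'forall_forallP h1 /'forall_forallP h2].
by case=> x [] y; rewrite /label_ok !mkqposetE ?ffunE //=; [exact: h1|exact: h2].
Qed.

(** A labeling with values in [k + l] is the juxtaposition of its parts below
and above k. Openness of O excludes the relations from the upper part to the
lower one, which the labels would violate. *)
Lemma card_labelings_cut (A : finType) (P : qposet A) (O : {set A}) k l :
  O \in opens P ->
  #|[set f in labelings P (k + l) | [set a | k <= f a] == O]| =
  #|labelings (restr P (~: O)) k| * #|labelings (restr P O) l|.
Proof.
rewrite inE => /'forall_'forall_implyP opO.
(* e identifies A with the disjoint union of the two restrictions *)
pose e (s : 'I_#|~: O| + 'I_#|O|) : A :=
  match s with inl i => enum_val i | inr j => enum_val j end.
have eO s : (e s \in O) = (if s is inr _ then true else false).
  case: s => i /=; last exact: enum_valP.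
  by apply/negbTE; have := enum_valP i; rewrite in_setC.
have e_bij : bijective e.
  apply: inj_card_bij; last by rewrite card_sum !card_ord addnC cardsC.
  move=> s t est; have := eO t; rewrite -est eO.
  by case: s t est => i [] j //= /enum_val_inj ->.
have [e' eK e'K] := e_bij.
pose glue (gh : {ffun 'I_#|~: O| -> 'I_k} * {ffun 'I_#|O| -> 'I_l}) :
    {ffun A -> 'I_(k + l)} :=
  [ffun a => match e' a with inl i => lshift l (gh.1 i)
                           | inr j => rshift k (gh.2 j) end].
have glue_l gh i : glue gh (enum_val i) = lshift l (gh.1 i).
  by rewrite ffunE -[enum_val i]/(e (inl i)) eK.
have glue_r gh j : glue gh (enum_val j) = rshift k (gh.2 j).
  by rewrite ffunE -[enum_val j]/(e (inr j)) eK.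
have glue_inj : injective glue.
  move=> [g h] [g' h'] /ffunP E; congr pair; apply/ffunP => x.
    by have := E (enum_val x); rewrite !glue_l => /lshift_inj.
  by have := E (enum_val x); rewrite !glue_r => /rshift_inj.
rewrite -cardsX -(card_imset _ glue_inj); apply: eq_card => f.
apply/idP/imsetP => [|[[g h] ]]; last first.
  rewrite !inE /= => /andP[/'forall_forallP hg /'forall_forallP hh] ->; apply/andP; split.
    apply/'forall_forallP => x y; rewrite -[x]e'K -[y]e'K.
    move: (e' x) (e' y) => [i|i] [j|j]; rewrite /label_ok /=.
    - by rewrite !glue_l -val_eqE; have := hg i j; rewrite /label_ok !qpullE.
    - by rewrite glue_l glue_r /= ltn_addr ?implybT.
    - apply/implyP => /(conj (eO (inr i)))[iO le_ij].
      by have := opO _ _ (introT andP (conj iO le_ij)); rewrite (eO (inl j)).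
    - rewrite !glue_r -val_eqE /= ltn_add2l eqn_add2l.
      by have := hh i j; rewrite /label_ok !qpullE -val_eqE.
  apply/eqP/setP => x; rewrite inE -[x]e'K eO; case: (e' x) => i /=.
    by rewrite glue_l /= leqNgt ltn_ord.
  by rewrite glue_r /= leq_addr.
rewrite !inE => /andP[/'forall_forallP hf /eqP/setP fO].
have {}fO x : (x \in O) = (k <= f x) by rewrite -fO inE.
have f_lt (i : 'I_#|~: O|) : f (enum_val i) < k.
  by have := eO (inl i); rewrite fO ltnNge => ->.
have f_ge (j : 'I_#|O|) : k <= f (enum_val j).
  by have := eO (inr j); rewrite fO.
have f_sub (j : 'I_#|O|) : f (enum_val j) - k < l.
  by have := ltn_ord (f (enum_val j)); have := f_ge j; lia.
exists ([ffun i => Ordinal (f_lt i)], [ffun j => Ordinal (f_sub j)]).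
  rewrite !inE; apply/andP; split; apply/'forall_forallP => x y.
    by have := hf (enum_val x) (enum_val y); rewrite /label_ok !qpullE !ffunE -!val_eqE.
  have := hf (enum_val x) (enum_val y); rewrite /label_ok !qpullE !ffunE -!val_eqE /=.
  have -> : (f (enum_val x) - k == f (enum_val y) - k) = (f (enum_val x) == f (enum_val y) :> nat).
    by have := f_ge x; have := f_ge y; lia.
  by rewrite ltn_sub2rE.
apply/ffunP => x; rewrite -[x]e'K; apply: val_inj; case: (e' x) => i.
  by rewrite glue_l /= ffunE.
by rewrite glue_r /= ffunE /= subnKC.
Qed.

(** The labels that are at least k are carried by an open set, since labels
grow along P; labelings are sorted according to this set. *)
Lemma card_labelingsD (A : finType) (P : qposet A) k l :
  #|labelings P (k + l)| = \sum_(O in opens P)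
    #|labelings (restr P (~: O)) k| * #|labelings (restr P O) l|.
Proof.
rewrite -sum1_card.
rewrite (partition_big (fun f : {ffun A -> 'I_(k + l)} => [set a | k <= f a])
  (mem (opens P))) /=.
  apply: eq_bigr => O opO; rewrite -card_labelings_cut // -sum1_card.
  by apply: eq_bigl => f; rewrite !inE.
move=> f; rewrite !inE => /'forall_forallP hf; apply/'forall_'forall_implyP => x y.
rewrite !inE => /andP[kx xy]; have := hf x y; rewrite /label_ok xy /=.
by case/orP => [/ltnW /(leq_trans kx)//|/andP[/eqP <-]].
Qed.
End Labelings.

(** * Hopf algebra morphisms given on a basis *)

Section Linear.
Variable K : fieldType.

Lemma linextE (B : choiceType) (V : lmodType K) (F : {malg K[B]} -> V) :
  linear F -> forall x, F x = linext (fun b => F << b >>) x.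
Proof.
move=> Flin x.
pose G : {linear {malg K[B]} -> V} :=
  HB.pack F (GRing.isLinear.Build _ _ _ _ F Flin).
rewrite {1}[x]monalgE -[F]/(G : _ -> _) linear_sum; apply: eq_bigr => b _.
rewrite -linearZ; congr (G _); apply/malgP => c.
by rewrite mcoeffZ !mcoeffU mulrnAr mulr1.
Qed.

Lemma linear_linext (B : choiceType) (V W : lmodType K) (F : V -> W)
    (h : B -> V) : linear F -> forall x, F (linext h x) = linext (F \o h) x.
Proof.
move=> Flin x.
pose G : {linear V -> W} := HB.pack F (GRing.isLinear.Build _ _ _ _ F Flin).
rewrite -[F]/(G : _ -> _) linear_sum; apply: eq_bigr => b _.
by rewrite linearZ.
Qed.

Lemma eq_linext (B : choiceType) (V : lmodType K) (h h' : B -> V) :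
  h =1 h' -> linext h =1 linext h'.
Proof. by move=> hh x; apply: eq_bigr => b _; rewrite hh. Qed.

(** Up to the form of the scalar action, [linext h] is the universal map out of
a monoid algebra attached to the monoid morphism h. *)
Lemma linext_monoid (B : monomType) (h : B -> {poly K}) :
  h mone = 1 -> {morph h : a b / mmul a b >-> a * b} ->
  monoid_morphism (linext h).
Proof.
move=> h1 hM.
have mm : @mmorphism B _ h by split.
pose H : {mmorphism B -> {poly K}} :=
  HB.pack h (monalg.isMultiplicative.Build _ _ h mm).
have E x : linext h x = mmap (polyC : {rmorphism K -> {poly K}}) H x.
  by apply: eq_bigr => b _; rewrite mul_polyC.
by split=> [|x y]; rewrite !E ?rmorph1 ?rmorphM.
Qed.

Lemma tensmap_linear (B : choiceType) (f : {malg K[B]} -> {poly K}) (a : K) u v :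
  tensmap f (a *: u + v) = a%:P%:P * tensmap f u + tensmap f v.
Proof.
rewrite /tensmap raddfD /=; congr (_ + _).
rewrite (mmapEw (msuppZ_le _ _)) mmapE big_distrr /=.
by apply: eq_bigr => c _; rewrite mcoeffZ /= !rmorphM; exact/esym/mulrA.
Qed.

Lemma tensmap_linext (B : choiceType) (f : {malg K[B]} -> {poly K})
    (cop : B -> {malg K[(B * B)%type]}) x :
  tensmap f (linext cop x) = \sum_(b <- msupp x) (x@_b)%:P%:P * tensmap f (cop b).
Proof.
rewrite /linext; elim/big_rec2: _ => [|b u v _ IH]; first exact: raddf0.
by rewrite tensmap_linear -IH.
Qed.

(** In K[X] (x) K[X], the substitution of - X for the first variable and X for
the second is multiplication after applying the antipode to the left factor. *)
Lemma tensmap_antidiag (B : choiceType) (f : {malg K[B]} -> {poly K}) u :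
  (tensmap f u).[- 'X] =
  linext (fun c => (f << c.1 >> \Po - 'X) * f << c.2 >>) u.
Proof.
rewrite /tensmap mmapE horner_sum; apply: eq_bigr => c _ /=.
by rewrite /polytens !hornerE -mul_polyC mulrA.
Qed.

Lemma poly_XaY_linear (a : K) (p q : {poly K}) :
  poly_XaY (a *: p + q) = a%:P%:P * poly_XaY p + poly_XaY q.
Proof.
by rewrite /poly_XaY rmorphD /= map_polyZ /= comp_polyD comp_polyZ mul_polyC.
Qed.

(** Compatibility with the antipode is deduced by induction on the size [sz]:
the coproduct of b consists of b (x) 1 and of terms, listed by [smaller], with
left factor smaller than b, so that a left convolution inverse of the morphism
is determined recursively. *)
Theorem hopf_morphism_linext (B : monomType)
    (cop : B -> {malg K[(B * B)%type]}) (h : B -> {poly K})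
    (sz : B -> nat) (smaller : B -> seq (B * B)) :
  h mone = 1 -> {morph h : a b / mmul a b >-> a * b} ->
  (forall b, (h b).[0] = (b == mone)%:R) ->
  (forall b, cop b = << (b, mone) >> + \sum_(c <- smaller b) << c >>) ->
  (forall b, all (fun c => sz c.1 < sz b)%N (smaller b)) ->
  (forall b, poly_XaY (h b) = tensmap (linext h) (cop b)) ->
  hopf_morphism cop (linext h).
Proof.
move=> h1 hM h0 copE sz_lt hcop; set f := linext h.
have flin : linear f by exact: linext_linear.
have [f1 fM] : monoid_morphism f by exact: linext_monoid.
have fcop x : poly_XaY (f x) = tensmap f (linext cop x).
  rewrite tensmap_linext {1}/f /linext.
  elim/big_rec2: _ => [|b u p _ IH]; first by rewrite /poly_XaY rmorph0 comp_poly0.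
  by rewrite poly_XaY_linear IH hcop.
have f0 x : (f x).[0] = counit x.
  rewrite /f /linext horner_sum /counit [x in RHS]monalgE raddf_sum /=.
  by apply: eq_bigr => b _; rewrite hornerZ h0 mcoeffU mulr_natr.
split=> // S [Slin Santi] x.
pose F y := f (S y); pose G y := f y \Po - 'X.
have Flin : linear F by move=> a y z; rewrite /F Slin flin.
have Glin : linear G by move=> a y z; rewrite /G flin comp_polyD comp_polyZ.
(* both F and G are left convolution inverses of f *)
suff FG b : F << b >> = G << b >>.
  by rewrite -/(F x) -/(G x) (linextE Flin) (linextE Glin); exact: eq_linext.
have convF y : linext (fun c => F << c.1 >> * f << c.2 >>) (linext cop y) = (counit y)%:P.
  transitivity (f (counit y)%:A).
    rewrite -(Santi y).1 (linear_linext _ flin).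
    by apply: eq_linext => c; rewrite /= fM.
  by rewrite /f linearZ /= [linext h 1]f1 alg_polyC.
have convG y : linext (fun c => G << c.1 >> * f << c.2 >>) (linext cop y) = (counit y)%:P.
  by rewrite -tensmap_antidiag -fcop (poly_antipode _).2 f0.
have [n] := ubnP (sz b); elim: n b => // n IH b; rewrite ltnS => sz_b.
have := convF << b >>; rewrite -(convG << b >>) linextU copE !linearD !linear_sum /=.
rewrite !linextU /=.
have -> : << mone >> = 1 :> {malg K[B]} by [].
rewrite f1 !mulr1 [X in _ = _ + X](eq_big_seq (fun c => linext (fun c => F << c.1 >> * f << c.2 >>) << c >>)).
  exact: addIr.
move=> c c_in; rewrite !linextU IH //.
exact: leq_trans (allP (sz_lt b) c c_in) sz_b.
Qed.
End Linear.

(** * Ehrhart polynomials of combinatorial Hopf algebras of quasi-posets *)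

Lemma qiso_card m n (P : qposet 'I_m) (Q : qposet 'I_n) : qiso P Q -> m = n.
Proof. by case/qisoP => f /bij_eq_card; rewrite !card_ord. Qed.

Section Ehrhart.
Variables (K : fieldType) (charK : [pchar K] =i pred0) (strict : bool).

(** [und] chooses a quasi-poset representing each basis element, and [l b O],
[r b O] are the two factors of the coproduct of b cut at O. Isomorphisms
suffice except for the term O = set0: the induction behind
[hopf_morphism_linext] needs its left factor to be b itself. *)
Theorem hopf_morphism_ehr (B : monomType)
    (cop : B -> {malg K[(B * B)%type]}) (und : B -> QP)
    (l r : forall b, {set 'I_(tag (und b))} -> B) :
  tag (und mone) = 0%N -> (forall b, tag (und b) = 0%N -> b = mone) ->
  (forall a b, qiso (tagged (und (mmul a b))) (qsum (tagged (und a)) (tagged (und b)))) ->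
  (forall b O, qiso (tagged (und (l b O))) (restr (tagged (und b)) (~: O))) ->
  (forall b O, qiso (tagged (und (r b O))) (restr (tagged (und b)) O)) ->
  (forall b, l b set0 = b) ->
  (forall b, cop b = \sum_(O in opens (tagged (und b))) << (l b O, r b O) >>) ->
  hopf_morphism cop (linext (fun b => map_poly ratr (ehrhart strict (tagged (und b))))).
Proof.
move=> und1 und0 undM undl undr l0 copE.
set h := fun b => _; pose nl b k := #|labelings strict (tagged (und b)) k|.
have h_nat b k : (h b).[k%:R] = (nl b k)%:R.
  exact/horner_ratr_nat/ehrhart_nat.
have set0_open b : set0 \in opens (tagged (und b)).
  by rewrite inE; apply/'forall_forallP => x y; rewrite inE.
have r0 b : r b set0 = mone by apply: und0; rewrite (qiso_card (undr b set0)) cards0.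
apply: (@hopf_morphism_linext _ _ _ _ (fun b => tag (und b)) (fun b =>
  [seq (l b V, r b V) | V <- enum (opens (tagged (und b)) :\ set0)])).
- apply: pchar0_poly_nat_inj => // k.
  by rewrite h_nat hornerC /nl card_labelings0 ?card_ord.
- move=> a b; apply: pchar0_poly_nat_inj => // k.
  by rewrite hornerM !h_nat -natrM -card_labelings_sum /nl (card_labelings_iso _ _ (undM a b)).
- move=> b; rewrite -[0]/(0%:R) h_nat /nl card_labelings_at0 card_ord; congr (_ _)%:R.
  by apply/eqP/eqP => [/und0|->].
- by move=> b; rewrite copE (big_setD1 set0) //= l0 r0 big_map big_enum.
- move=> b; apply/allP => _ /mapP[V V_in ->] /=.
  have V0 : V != set0 by move: V_in; rewrite mem_enum !inE => /andP[].
  rewrite (qiso_card (undl b V)) -[X in (_ < X)%N]card_ord -(cardsC V).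
  by rewrite -[X in (X < _)%N]add0n ltn_add2r card_gt0.
move=> b; apply: pchar0_poly2_nat_inj => // i j.
rewrite copE /tensmap raddf_sum /= !horner_sum.
(* the value of p^:P at a polynomial q is the composition p \Po q, for which
   [horner_comp] computes the second evaluation *)
transitivity ((nl b (i + j)%N)%:R : K).
  rewrite -h_nat /poly_XaY horner_comp hornerD hornerX hornerC.
  rewrite -/(_ \Po _) horner_comp hornerD hornerX.
  by rewrite hornerMn hornerC natrD.
rewrite /nl card_labelingsD natr_sum; apply: eq_bigr => O _.
rewrite [mmap _ _ _]mmapU /= mul1r /polytens !linextU.
rewrite natrM -(card_labelings_iso _ _ (undl b O)) -(card_labelings_iso _ _ (undr b O)).
rewrite -!/(nl _ _) -!h_nat.
rewrite !hornerM hornerC -/(_ \Po _) horner_comp.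
by rewrite hornerMn hornerC.
Qed.
End Ehrhart.

(** * Quasi-posets, their isoclasses, and isoclasses of posets *)

(** Standardization does nothing to a quasi-poset that is already on an initial
segment. The subset A is only propositionally equal to [setT], so as to apply to
[~: set0]: the type of [restr] depends on A, which precludes rewriting. *)
Lemma QPof_restrT (P : QP) (A : {set 'I_(tag P)}) :
  A = setT -> QPof (restr (tagged P) A) = P.
Proof.
move=> AT; have cA : #|A| = tag P by rewrite AT cardsT card_ord.
have dom (i : nat) : (i < #|A|)%N = (i < tag P)%N by rewrite cA.
have valE (i : 'I_#|A|) : val (enum_val i) = i.
  have i_lt : (i < tag P)%N by apply: leq_trans (ltn_ord i) _; rewrite cA.
  have eA : enum A = enum 'I_(tag P) by apply: eq_enum => x; rewrite AT inE.
  rewrite (enum_val_nth (Ordinal i_lt)) eA.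
  by rewrite [LHS](nth_enum_ord _ i_lt).
apply: QP_eq => //= i j.
have [i_lt|i_ge] := ltnP i #|A|; last first.
  by apply/idP/idP => /nle_dom /= /andP[lt_i _]; move: i_ge;
    rewrite leqNgt ?lt_i // dom lt_i.
have [j_lt|j_ge] := ltnP j #|A|; last first.
  by apply/idP/idP => /nle_dom /= /andP[_ lt_j]; move: j_ge;
    rewrite leqNgt ?lt_j // dom lt_j.
have := nleE (Ordinal i_lt : 'I_(tag (QPof (restr (tagged P) A)))) (Ordinal j_lt).
rewrite /= qpullE => ->.
by rewrite -nleE -[nat_of_ord _]/(val _) !valE.
Qed.

Lemma qiso_QPmul (P Q : QP) : qiso (tagged (QPmul P Q)) (qsum (tagged P) (tagged Q)).
Proof. by apply/isoclass_eq; rewrite isoclass_QPmul qpmulE. Qed.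

Lemma isoclass_restrC0 (c : qp) :
  isoclass (restr (tagged (rep c)) (~: set0)) = c.
Proof.
rewrite -[RHS]isoclass_rep.
exact: (congr1 (fun P : QP => isoclass (tagged P)) (QPof_restrT (setC0 _))).
Qed.

Lemma tag_rep1 : tag (rep qp1) = 0%N.
Proof. exact/qiso_card/rep_iso. Qed.

Lemma tag_rep_eq0 (c : qp) : tag (rep c) = 0%N -> c = qp1.
Proof. by move=> /QP_tag0 e; rewrite -[c]isoclass_rep e. Qed.

Section Instances.
Variables (K : fieldType) (charK : [pchar K] =i pred0) (strict : bool).

Lemma hopf_morphism_ehrQP : hopf_morphism (@copQP K)
  (linext (fun P : QP => map_poly ratr (ehrhart strict (tagged P)))).
Proof.
apply: (@hopf_morphism_ehr _ charK strict _ _ id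
  (fun P U => QPof (restr (tagged P) (~: U))) (fun P U => QPof (restr (tagged P) U))) => //.
- exact: QP_tag0.
- exact: qiso_QPmul.
- by move=> *; apply: qiso_refl.
- by move=> *; apply: qiso_refl.
- by move=> P; apply: QPof_restrT; rewrite setC0.
Qed.

Lemma hopf_morphism_ehrqp : hopf_morphism (@copqp K)
  (linext (fun c : qp => map_poly ratr (ehrhart strict (tagged (rep c))))).
Proof.
apply: (@hopf_morphism_ehr _ charK strict _ _ rep
  (fun c U => isoclass (restr (tagged (rep c)) (~: U)))
  (fun c U => isoclass (restr (tagged (rep c)) U))) => //.
- exact: tag_rep1.
- exact: tag_rep_eq0.
- by move=> c d; apply: rep_iso.
- by move=> *; apply: rep_iso.
- by move=> *; apply: rep_iso.
- exact: isoclass_restrC0.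
Qed.

Lemma hopf_morphism_ehrp : hopf_morphism (@copp K)
  (linext (fun c : posetclass => map_poly ratr (ehrhart strict (tagged (rep (val c)))))).
Proof.
apply: (@hopf_morphism_ehr _ charK strict posetclass _ (fun c : posetclass => rep (val c))
  (fun c U => pclass (antisym_restr (~: U) (valP c)))
  (fun c U => pclass (antisym_restr U (valP c)))) => //.
- exact: tag_rep1.
- by move=> c /tag_rep_eq0 c1; apply: val_inj.
- by move=> c d; apply: rep_iso.
- by move=> *; apply: rep_iso.
- by move=> *; apply: rep_iso.
- by move=> c; apply: val_inj; apply: isoclass_restrC0.
Qed.
End Instances.

Theorem theorem23 (K : fieldType) (charK : [pchar K]%R =i pred0) :
  (hopf_morphism (@copQP K) (@ehrQP K) /\
   hopf_morphism (@copQP K) (@ehrstrQP K)) /\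
  (hopf_morphism (@copqp K) (@ehrqp K) /\
   hopf_morphism (@copqp K) (@ehrstrqp K)) /\
  (hopf_morphism (@copp K) (@ehrp K) /\
   hopf_morphism (@copp K) (@ehrstrp K)).
Proof.
split; [|split]; split.
- exact: (hopf_morphism_ehrQP charK false).
- exact: (hopf_morphism_ehrQP charK true).
- exact: (hopf_morphism_ehrqp charK false).
- exact: (hopf_morphism_ehrqp charK true).
- exact: (hopf_morphism_ehrp charK false).
- exact: (hopf_morphism_ehrp charK true).
Qed.
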